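(* Let $n\ge2$, $1\le p\le n-1$, and let $\pi\in S_n$ be a $p$-resultant permutation such that $\pi^{\text{left}}$ has $i$ left-to-right maxima and $\pi^{\text{right}}$ has $j$ right-to-left minima. Then the number of configurations in $\mathcal{S}(n-1,p)$ that topple to $\pi$ is $\tfrac12 B_{i,j}$.
   Context: For $m\ge1$, $1\le p\le m$: sites are $0,\dots,m+1$; a configuration in $\mathcal{S}(m,p)$ places $m+1$ distinct chips labeled $1,\dots,m+1$ with sites $0,m+1$ empty, one chip at each site of $\{1,\dots,m\}\setminus\{p\}$ and two chips at site $p$. Toppling: while some site holds at least two chips, choose such a site $i$ and two chips $\alpha<\beta$ there and move $\alpha$ to $i-1$, $\beta$ to $i+1$. It is known this terminates with at most one chip per site and the final configuration is independent of the choices; reading labels left to right gives a permutation in $S_{m+1}$ to which the configuration topples. $\pi\in S_n$ is $p$-resultant if some configuration in $\mathcal{S}(n-1,p)$ topples to it; then $\pi^{\text{left}}=(\pi_1,\dots,\pi_{n-p})$ is a permutation of $[n-p]$ and $\pi^{\text{right}}=(\pi_{n-p+1},\dots,\pi_n)$ a permutation of $\{n-p+1,\dots,n\}$. Left-to-right maximum of $a_1\cdots a_k$: an entry $a_j=\max\{a_1,\dots,a_j\}$; right-to-left minimum: an entry $a_j=\min\{a_j,\dots,a_k\}$. Poly-Bernoulli numbers of type B: $\sum_{n\ge0}B_{n,k}\frac{x^n}{n!}=\frac{\mathrm{Li}_{-k}(1-e^{-x})}{1-e^{-x}}$ with $\mathrm{Li}_s(z)=\sum_{i\ge1}z^i/i^s$;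 equivalently $B_{n,k}=\sum_{m=0}^{\min(n,k)}(m!)^2\left\{{n+1\atop m+1}\right\}\left\{{k+1\atop m+1}\right\}$. *)

(* Defs.v *)
From mathcomp Require Import all_boot all_order all_algebra.
Set Implicit Arguments. Unset Strict Implicit. Unset Printing Implicit Defensive.
Import Order.TTheory GRing.Theory Num.Theory.

(* Chip-firing with labeled chips on a line.
   A configuration with m+1 chips is a map  c : 'I_(m+1) -> int  sending
   chip k (which carries the label k+1) to its site (an integer).          *)

Definition lconf (m : nat) := 'I_(m+1) -> int.

Definition topple_step (m : nat) (c c' : lconf m) : Prop :=
  exists (i : int) (a b : 'I_(m+1)),
    (a < b)%N /\ c a = i /\ c b = i /\
    forall k, c' k = (if k == a then i - 1 else if k == b then i + 1 else c k)%R.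

Inductive topple_reach (m : nat) : lconf m -> lconf m -> Prop :=
| reach_refl c c' : (forall k, c k = c' k) -> topple_reach c c'
| reach_step c c' c'' : topple_step c c' -> topple_reach c' c'' -> topple_reach c c''.

Definition stable (m : nat) (c : lconf m) : Prop :=
  forall a b : 'I_(m+1), c a = c b -> a = b.

Definition reading (m : nat) (c : lconf m) : seq nat :=
  map (fun k : 'I_(m+1) => (nat_of_ord k).+1)
      (sort (fun a b : 'I_(m+1) => (c a <= c b)%R) (enum 'I_(m+1))).

(* c topples to the permutation (word) pi: some toppling sequence ends at a
   stable configuration whose reading is pi (the final configuration is
   known to be unique, independent of choices). *)
Definition topples_to (m : nat) (c : lconf m) (pi : seq nat) : Prop :=
  exists c' : lconf m, topple_reach c c' /\ stable c' /\ reading c' = pi.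

Definition iconf (m : nat) := {ffun 'I_(m+1) -> 'I_(m+2)}.
Definition as_lconf (m : nat) (c : iconf m) : lconf m :=
  fun k => ((nat_of_ord (c k))%:Z)%R.

Definition in_S (m : nat) (p : nat) (c : iconf m) : bool :=
  [forall s : 'I_(m+2),
     #|[set k | c k == s]| ==
       (if (1 <= s <= m)%N then (if nat_of_ord s == p then 2 else 1) else 0)%N].

Arguments in_S : clear implicits.

Definition p_resultant (n p : nat) (pi : seq nat) : Prop :=
  exists c : iconf n.-1, in_S n.-1 p c /\ topples_to (as_lconf c) pi.

Definition lr_maxima (s : seq nat) : nat :=
  count (fun j => all (fun x => x <= nth 0 s j) (take j s)) (iota 0 (size s)).
Definition rl_minima (s : seq nat) : nat :=
  count (fun j => all (fun x => nth 0 s j <= x) (drop j.+1 s)) (iota 0 (size s)).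

Fixpoint stirling2 (n k : nat) : nat :=
  match n, k with
  | 0, 0 => 1
  | 0, _.+1 => 0
  | _.+1, 0 => 0
  | n'.+1, k'.+1 => k'.+1 * stirling2 n' k'.+1 + stirling2 n' k'
  end.

Definition polyBernoulliB (n k : nat) : nat :=
  \sum_(0 <= m < (minn n k).+1) (m`! ^ 2 * stirling2 n.+1 m.+1 * stirling2 k.+1 m.+1).

Arguments p_resultant : clear implicits.

(* Main.v *)
Require Import Defs.
From mathcomp Require Import all_boot all_order all_algebra.
From mathcomp Require Import boolp.
From mathcomp Require Import zify.
Import Order.TTheory GRing.Theory Num.Theory.

(** The topplings form a p x (n - p) grid of comparators. The chips starting on
the sites 1..p, with one of the two chips of p, travel right as rows; those
starting on p..n-1, with the other chip of p, travel left as columns. When a row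
meets a column, the row keeps the larger label and the column the smaller one.
A row thus performs a bubble-sort pass over the word of the columns.

Undoing a pass amounts to choosing a set of left-to-right maxima of the column
word, and a pass can be undone nontrivially only for the rows that end in a
right-to-left minimum of the right part. Keeping track of the number of
left-to-right maxima of the column word turns the count N(i, j) of the inputs of
the grid into the recurrence
  N(i, j+1) = N(i, j) + sum_(r < i) C(i, r) N(r+1, j)
of the poly-Bernoulli numbers. Each configuration is counted twice, since the
two chips of the site p can be exchanged. *)

(** * Stirling numbers and the poly-Bernoulli recurrence *)

Lemma stirling2S n k :
  stirling2 n.+1 k.+1 = k.+1 * stirling2 n k.+1 + stirling2 n k.
Proof. by []. Qed.

Lemma stirling2_small n k : n < k -> stirling2 n k = 0.
Proof.
elim: n k => [|n IHn] [|k] //= ltnk.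
by rewrite !IHn ?muln0 // ltnW.
Qed.

(** Classify the partitions of n + 1 points by the r points outside the block of a distinguished
    one; formally, Pascal's rule and induction. *)
Lemma sum_bin_stirling2 n k :
  \sum_(0 <= r < n.+1) 'C(n, r) * stirling2 r k = stirling2 n.+1 k.+1.
Proof.
elim: n k => [|n IHn] k; first by rewrite big_nat1 bin0 /= muln0 mul1n.
have split_sum f : \sum_(0 <= r < n.+2) 'C(n.+1, r) * f r =
    \sum_(0 <= r < n.+1) 'C(n, r) * f r + \sum_(0 <= r < n.+1) 'C(n, r) * f r.+1.
  rewrite big_nat_recl // bin0.
  rewrite (eq_bigr (fun r => 'C(n, r.+1) * f r.+1 + 'C(n, r) * f r.+1)); last first.
    by move=> r _; rewrite binS mulnDl.
  rewrite big_split /= addnA; congr (_ + _).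
  rewrite [in RHS]big_nat_recl // bin0 [in LHS]big_nat_recr //= bin_small //.
  by rewrite mul0n addn0.
rewrite split_sum IHn.
case: k => [|k].
  rewrite [X in _ + X]big1; last by move=> r _; rewrite muln0.
  by rewrite addn0 [RHS]/= mul1n addn0.
rewrite (eq_bigr (fun r => k.+1 * ('C(n, r) * stirling2 r k.+1)
                           + 'C(n, r) * stirling2 r k)); last first.
  by move=> r _ /=; rewrite mulnDr mulnCA.
by rewrite big_split /= -big_distrr /= !IHn /=; lia.
Qed.

(** Evaluates the inner sum of [polyBernoulliB_rec], in a form that a shift of m matches with the
    other side of the recurrence. *)
Lemma stirling2_rec2 n m :
  \sum_(0 <= r < n) 'C(n, r) * stirling2 r.+2 m.+1 =
  m * stirling2 n.+1 m.+1 + m.+1 ^ 2 * stirling2 n.+1 m.+2.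
Proof.
(* Supplying the missing term r = n makes [sum_bin_stirling2] applicable. *)
apply/(@addIn (stirling2 n.+2 m.+1)).
have -> : \sum_(0 <= r < n) 'C(n, r) * stirling2 r.+2 m.+1 + stirling2 n.+2 m.+1
   = \sum_(0 <= r < n.+1) 'C(n, r) * stirling2 r.+2 m.+1.
  by rewrite big_nat_recr //= binn mul1n.
case: m => [|m].
  rewrite (eq_bigr (fun r => 'C(n, r) * stirling2 r 1 + 'C(n, r) * stirling2 r 0)).
    by rewrite big_split /= !sum_bin_stirling2 /=; lia.
  by move=> r _; case: r => [|r] /=; lia.
have linear K L : \sum_(0 <= r < n.+1) 'C(n, r) *
      (K * stirling2 r m.+2 + (L * stirling2 r m.+1 + stirling2 r m)) =
    K * stirling2 n.+1 m.+3 + (L * stirling2 n.+1 m.+2 + stirling2 n.+1 m.+1).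
  rewrite -!sum_bin_stirling2 !big_distrr -!big_split /=.
  by apply: eq_bigr => r _; lia.
rewrite [stirling2 n.+2 _]stirling2S -[RHS]addnA.
(* These coefficients come from applying the Stirling recurrence twice to [stirling2 r.+2 m.+2]; 2m
   + 3 is (m + 2) + (m + 1). *)
have := linear (m.+2 ^ 2) (2 * m + 3).
under eq_bigr => r _.
  have -> : m.+2 ^ 2 * stirling2 r m.+2 +
      ((2 * m + 3) * stirling2 r m.+1 + stirling2 r m) = stirling2 r.+2 m.+2.
    by rewrite !stirling2S; nia.
  over.
by move=> ->; nia.
Qed.

(** Gives all sums of the recurrence a common range: beyond min(n, k) one Stirling factor
    vanishes. *)
Lemma polyBernoulliB_widen M n k : minn n k <= M ->
  polyBernoulliB n k =
  \sum_(0 <= m < M.+1) m`! ^ 2 * stirling2 n.+1 m.+1 * stirling2 k.+1 m.+1.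
Proof.
move=> leM; rewrite /polyBernoulliB (big_cat_nat (leq0n (minn n k).+1) (_ : _ <= M.+1)) //.
rewrite -[LHS]addn0; congr addn; rewrite big_nat_cond big1 // => m.
rewrite andbT gtn_min ltnS => /andP[/orP[lt|lt] _].
  by rewrite [stirling2 n.+1 _]stirling2_small ?muln0 ?mul0n.
by rewrite [stirling2 k.+1 _]stirling2_small ?muln0 ?mul0n.
Qed.

Lemma polyBernoulliB0 n : polyBernoulliB n 0 = 1.
Proof.
rewrite /polyBernoulliB minn0 big_nat1 /= !muln1 mul1n.
by elim: n => //= n; rewrite mul1n addn0.
Qed.

#[local] Arguments stirling2 : simpl never.

Lemma polyBernoulliB_rec n k :
  polyBernoulliB n k.+1 = polyBernoulliB n k
    + \sum_(0 <= r < n) 'C(n, r) * polyBernoulliB r.+1 k.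
Proof.
rewrite (@polyBernoulliB_widen k.+1 n k.+1) ?geq_minr //.
rewrite (@polyBernoulliB_widen k n k) ?geq_minr //.
under [X in _ = _ + X]eq_bigr => r _ do
  rewrite (@polyBernoulliB_widen k) ?geq_minr // big_distrr /=.
rewrite exchange_big /= -big_split /=.
rewrite (eq_bigr (fun m =>
   m`! ^ 2 * stirling2 n.+1 m.+1 * (m.+1 * stirling2 k.+1 m.+1) +
   m`! ^ 2 * stirling2 n.+1 m.+1 * stirling2 k.+1 m)); last first.
  by move=> m _; rewrite -mulnDr.
(* The first half loses its top term, as S(k+1, k+2) = 0, the second its bottom term, as S(k+1, 0) =
   0; after this shift the two sides agree for each m. *)
rewrite big_split [X in X + _ = _]big_nat_recr //=.
rewrite [stirling2 k.+1 k.+2]stirling2_small // !muln0 addn0.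
rewrite [X in _ + X]big_nat_recl // muln0 add0n -big_split /=.
apply: eq_bigr => m _.
rewrite (eq_bigr (fun r => m`! ^ 2 * stirling2 k.+1 m.+1 *
   ('C(n, r) * stirling2 r.+2 m.+1))); last by move=> r _; lia.
by rewrite -big_distrr /= stirling2_rec2 factS; nia.
Qed.

(** * Passes, the comparator grid and their preimages *)

Fixpoint pass (a : nat) (w : seq nat) : seq nat * nat :=
  if w is b :: w' then
    let: (u, v) := pass (maxn a b) w' in (minn a b :: u, v)
  else ([::], a).

(* R and w list rows and columns by increasing starting site, so the last row of
   R, which starts at the doubled site, fires first. *)
Fixpoint net (R w : seq nat) : seq nat * seq nat :=
  if R is a :: R' then
    let: (vs, w') := net R' w in let: (u, v) := pass a w' in (v :: vs, u)
  else ([::], w).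

(** Undoes the first comparator: b is its smaller output, so the larger one, carried on as [z.1],
    entered either on the row (no swap) or on the column (swap). *)
Fixpoint pass_pre (u : seq nat) (v : nat) : seq (nat * seq nat) :=
  if u is b :: u' then
    flatten [seq [:: (z.1, b :: z.2); (b, z.1 :: z.2)] | z <- pass_pre u' v & b < z.1]
  else [:: (v, [::])].

Fixpoint net_pre (vs u : seq nat) : seq (seq nat * seq nat) :=
  if vs is v :: vs' then
    flatten [seq [seq (z.1 :: y.1, y.2) | y <- net_pre vs' z.2] | z <- pass_pre u v]
  else [:: ([::], u)].

(** As labels are distinct, a comparator never sees a tie, so the strict test [b < z.1] discards no
    preimage. *)
Lemma pass_preP u v a w : uniq (a :: w) ->
  ((a, w) \in pass_pre u v) = (pass a w == (u, v)).
Proof.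
elim: u v a w => [|b u IHu] v a w; rewrite /pass_pre -/pass_pre.
  case: w => [|c w] _ /=; last by case: (pass _ _) => ? ?; rewrite inE !xpair_eqE /= andbF.
  by rewrite inE !xpair_eqE eqxx andbT.
case: w => [|c w] Uaw.
  rewrite [RHS]/=; apply/negbTE/negP => /flatten_mapP[[a' w'] _].
  by rewrite !inE !xpair_eqE /= !andbF.
have [nac Uac Ucw] : [/\ a != c, uniq (a :: w) & uniq (c :: w)].
  by move: Uaw; rewrite /= inE negb_or => /and3P[/andP[-> ->] -> ->].
have Umax : uniq (maxn a c :: w) by case: leqP.
apply/flatten_mapP/idP => [[[m w']]|].
  rewrite mem_filter /= !inE => /andP[ltbm mem_pre] /orP[]/eqP[].
    move=> ? ? ?; subst; have lem : maxn m b = m by lia.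
    move: (IHu v m w' Uac); rewrite mem_pre => /esym/eqP.
    by rewrite lem => ->; rewrite (minn_idPr _) // ltnW.
  move=> ? ? ?; subst; have lem : maxn b m = m by lia.
  move: (IHu v m w' Ucw); rewrite mem_pre => /esym/eqP.
  by rewrite lem => ->; rewrite (minn_idPl _) // ltnW.
rewrite /=; case E: (pass _ _) => [u' v'] /eqP[Eb Eu Ev]; subst u' v'.
exists (maxn a c, w).
  by rewrite mem_filter IHu // E eqxx andbT /= -Eb; lia.
rewrite !inE !xpair_eqE /= -Eb !eqseq_cons.
by case: (ltngtP a c) nac => //=; rewrite ?eqxx ?orbT.
Qed.

Lemma pass_perm a w u v : pass a w = (u, v) -> perm_eq (v :: u) (a :: w).
Proof.
elim: w a u v => [|b w IHw] a u v /=; first by case=> <- <-.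
case E: (pass _ _) => [u' v'] [<- <-].
have := IHw _ _ _ E => P.
rewrite -[X in perm_eq X _]/([:: v'] ++ [:: minn a b] ++ u') perm_catCA /=.
apply: (@perm_trans _ (minn a b :: maxn a b :: w)); first by rewrite perm_cons.
case: leqP => // _.
by rewrite -[X in perm_eq X _]/([:: b] ++ [:: a] ++ w) perm_catCA.
Qed.

Lemma net_perm R w vs u : net R w = (vs, u) -> perm_eq (vs ++ u) (R ++ w).
Proof.
elim: R vs u => [|a R IHR] vs u /=; first by case=> <- <-.
case E: (net R w) => [vs' w']; case F: (pass a w') => [u' v'] [<- <-] /=.
have := IHR _ _ E; rewrite -(perm_cons a); apply: perm_trans.
rewrite -cat_cons perm_catC.
have := pass_perm _ _ _ _ F; rewrite -(perm_cat2r vs') => P.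
apply: perm_trans (_ : perm_eq (u' ++ v' :: vs') (v' :: u' ++ vs')) _.
  by rewrite -cat1s perm_catCA.
apply: (perm_trans P); rewrite /= perm_cons perm_catC //.
Qed.

Lemma net_size R w vs u : net R w = (vs, u) -> size vs = size R /\ size u = size w.
Proof.
elim: R vs u => [|a R IHR] vs u /=; first by case=> <- <-.
case E: (net R w) => [vs' w']; case F: (pass a w') => [u' v'] [<- <-] /=.
have [<- <-] := IHR _ _ E; split=> //.
by have /perm_size[] := pass_perm _ _ _ _ F.
Qed.

Lemma net_preP vs u R w : uniq (R ++ w) ->
  ((R, w) \in net_pre vs u) = (net R w == (vs, u)).
Proof.
elim: vs u R w => [|v vs IHvs] u R w URw; rewrite /net_pre -/net_pre.
  case: R URw => [|a R] _ /=; first by rewrite inE !xpair_eqE eqxx.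
  by case: (net R w) => vs' w'; case: (pass a w').
case: R URw => [|a R] URw.
  rewrite [RHS]/=; apply/negbTE/negP => /flatten_mapP[z _ /mapP[y _]]. by [].
have UR : uniq (R ++ w) by case/andP: URw.
case E: (net R w) => [vs1 w1].
have Uaw1 : uniq (a :: w1).
  have := net_perm _ _ _ _ E; rewrite -(perm_cons a) => /perm_uniq.
  rewrite -[a :: R ++ w]/((a :: R) ++ w) URw /= mem_cat cat_uniq.
  by case/andP; rewrite negb_or => /andP[_ ->] /and3P[].
rewrite /= E; apply/flatten_mapP/idP => [[[a' w'] /= mem1 /mapP[[R' y] /= mem2 []]]|].
  move=> *; subst; move: mem2; rewrite IHvs // E => /eqP[? ?]; subst.
  by move: mem1; rewrite pass_preP // => /eqP ->.
case F: (pass a w1) => [u' v'] /eqP[? ? ?]; subst.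
exists (a, w1); first by rewrite pass_preP // F.
by apply/mapP; exists (R, w) => //=; rewrite IHvs // E.
Qed.

(** * Left-to-right maxima of the preimages of a pass *)

Fixpoint records (t : nat) (w : seq nat) : nat :=
  if w is b :: w' then if t < b then (records b w').+1 else records t w' else 0.

(* The pairs (number of records of w, number of records of w exceeding a), where
   (a, w) runs over the preimages of a pass. The second statistic becomes the
   first one when the carried chip a is swapped with a newly met column. *)
Fixpoint record_pairs (i : nat) : seq (nat * nat) :=
  if i is i'.+1 then
    flatten [seq [:: (z.1.+1, z.2); (z.2.+1, z.2.+1)] | z <- record_pairs i']
  else [:: (0, 0)].

(** Induction on the first column b. If b < t, only the unswapped preimage carries a label above t,
    and b adds to neither count. If b > t, both preimages survive and b is the next threshold: the
    unswapped one adds b to the first count; in the swapped one the column m > b is a record for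
    both counts and hides the records below it. *)
Lemma record_pairs_pre u v t : uniq u -> t \notin u -> all (ltn^~ v) u -> t < v ->
  [seq (records t z.2, records z.1 z.2) | z <- pass_pre u v & t < z.1] =
  record_pairs (records t u).
Proof.
elim: u t => [|b u IHu] t /=; first by move=> _ _ _ ->.
move=> /andP[nbu Uu]; rewrite inE negb_or => /andP[ntb ntu] /andP[ltbv ltuv] lttv.
rewrite filter_flatten map_flatten -!map_comp.
case: ltnP => [lttb|lebt].
  rewrite [RHS]/= -(IHu b) // -map_comp; congr flatten. apply/eq_in_map => -[m w].
  rewrite mem_filter /= => /andP[ltbm _].
  by rewrite lttb (ltn_trans lttb ltbm) /= lttb ltbm ltnNge (ltnW ltbm) (ltn_trans lttb ltbm).
have ltbt : b < t by rewrite ltn_neqAle eq_sym ntb.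
rewrite [RHS]/= -(IHu t) // => {IHu}.
elim: (pass_pre u v) => //= -[m w] l IHl /=.
case: (ltnP b m) => [ltbm|lemb] /=; last first.
  by rewrite IHl ltnNge (leq_trans lemb lebt).
rewrite IHl [t < b]ltnNge lebt /=.
by case: ltnP => //= lttm; rewrite ltnNge lebt /= ltnNge (ltnW ltbm).
Qed.

(** Of the two children of a pair, one keeps the second entry and one increments it, so the value r
    occurs C(i, r) times. *)
Lemma sum_record_pairs_snd i g :
  \sum_(z <- record_pairs i) g z.2 = \sum_(0 <= r < i.+1) 'C(i, r) * g r.
Proof.
elim: i g => [|i IHi] g; first by rewrite big_seq1 big_nat1 bin0 mul1n.
rewrite big_flatten /= big_map.
under eq_bigr => z _ do rewrite big_cons big_seq1 /=.
rewrite big_split /= (IHi g) (IHi (fun r => g r.+1)).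
rewrite [RHS]big_nat_recl // bin0 /=.
under [in RHS]eq_bigr => r _ do rewrite binS mulnDl.
rewrite big_split /= [in LHS]big_nat_recl // bin0 -addnA; congr (_ + (_ + _)).
by rewrite [RHS]big_nat_recr //= bin_small // mul0n addn0.
Qed.

(** The term [g i] is the choice without swaps; a swap overwrites the first entry by the successor
    of the second, which is binomially distributed. With g = B(., j) this is the right side of
    [polyBernoulliB_rec]. *)
Lemma sum_record_pairs_fst i g :
  \sum_(z <- record_pairs i) g z.1 = g i + \sum_(0 <= r < i) 'C(i, r) * g r.+1.
Proof.
elim: i g => [|i IHi] g; first by rewrite big_seq1 big_geq ?addn0.
rewrite big_flatten /= big_map.
under eq_bigr => z _ do rewrite big_cons big_seq1 /=.
rewrite big_split /= (IHi (fun r => g r.+1)) (sum_record_pairs_snd i (fun r => g r.+1)).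
rewrite -addnA; congr (_ + _).
rewrite [X in _ + X]big_nat_recl // [RHS]big_nat_recl // !bin0.
under [in RHS]eq_bigr => r _ do rewrite binS mulnDl.
by rewrite big_split /= addnCA; congr (_ + _); exact: addnC.
Qed.

(** * Counting the inputs of the grid *)

Fixpoint minima (s : seq nat) : nat :=
  if s is v :: s' then all (ltn v) s' + minima s' else 0.

(** Preimages are counted as list lengths, so repetitions must be excluded. The row input, b or some
    m > b, tells which branch was taken. *)
Lemma pass_pre_uniq u v : uniq (pass_pre u v).
Proof.
elim: u => //= b u IHu.
have : uniq [seq z <- pass_pre u v | b < z.1] by rewrite filter_uniq.
have : all (fun z => b < z.1) [seq z <- pass_pre u v | b < z.1] by apply: filter_all.
elim: [seq z <- _ | _] => //= -[m w] l IHl /andP[/= ltbm ltl] /andP[nml Ul].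
rewrite IHl // andbT !inE !xpair_eqE /= negb_or.
apply/andP; split; first (apply/andP; split).
- by rewrite (gtn_eqF ltbm).
- apply/negP => /flatten_mapP[[m' w'] memz]; rewrite !inE !xpair_eqE !eqseq_cons eqxx /=.
  case/orP=> [/andP[/eqP ? /eqP ?]|/and3P[/eqP]]; first by subst; rewrite memz in nml.
  by move=> ?; lia.
apply/negP => /flatten_mapP[[m' w'] memz]; rewrite !inE !xpair_eqE !eqseq_cons /=.
case/orP=> [/and3P[/eqP ? /eqP ? _]|/and3P[_ /eqP ? /eqP ?]]; last by subst; rewrite memz in nml.
by subst; have := allP ltl _ memz; rewrite /= ltnn.
Qed.

Lemma pass_max a w : all (ltn^~ a) w -> pass a w = (w, a).
Proof.
elim: w => //= b w IHw /andP[ltba ltwa].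
by rewrite (maxn_idPl (ltnW ltba)) IHw // (minn_idPr (ltnW ltba)).
Qed.

Lemma pass_pre_pass u v a w : (a, w) \in pass_pre u v -> pass a w = (u, v).
Proof.
elim: u a w => [|b u IHu] a w /=; first by rewrite inE => /eqP[-> ->].
case/flatten_mapP=> -[m w']; rewrite mem_filter !inE /= => /andP[ltbm /IHu E].
case/orP=> /eqP[-> ->] /=.
  by rewrite (maxn_idPl (ltnW ltbm)) E (minn_idPr (ltnW ltbm)).
by rewrite (maxn_idPr (ltnW ltbm)) E (minn_idPl (ltnW ltbm)).
Qed.

Lemma net_pre_net vs u R w : (R, w) \in net_pre vs u -> net R w = (vs, u).
Proof.
elim: vs u R w => [|v vs IHvs] u R w /=; first by rewrite inE => /eqP[-> ->].
case/flatten_mapP=> -[m w'] /pass_pre_pass E /mapP[[R1 y] /= /IHvs F [-> ->]] /=.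
by rewrite F E.
Qed.

Lemma net_pre_uniq vs u : uniq (net_pre vs u).
Proof.
elim: vs u => //= v vs IHvs u.
elim: (pass_pre u v) (pass_pre_uniq u v) => //= -[m w] l IHl /andP[nml Ul].
rewrite cat_uniq IHl // andbT map_inj_uniq ?IHvs /=; last first.
  by move=> [R y] [R' y'] /= [-> ->].
apply/hasPn => z /flatten_mapP[[m' w'] memz /mapP[[R1 y1] /= /net_pre_net E1 ->]].
apply/negP => /mapP[[R2 y2] /= /net_pre_net E2 [em eR ey]].
by move: E1; rewrite eR ey E2 => -[ew]; rewrite -em ew memz in nml.
Qed.

Lemma pass_pre_id u v : all (ltn^~ v) u -> uniq u -> (v, u) \in pass_pre u v.
Proof.
move=> ltuv Uu; rewrite pass_preP ?pass_max //= Uu andbT.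
by apply/negP => /(allP ltuv) /=; rewrite ltnn.
Qed.

Lemma pass_pre_lt u v z : z \in pass_pre u v -> all (ltn^~ v) u.
Proof.
elim: u z => //= b u IHu z /flatten_mapP[[m w]]; rewrite mem_filter /= => /andP[ltbm mem] _.
rewrite (IHu _ mem) andbT (leq_trans ltbm) //.
have : m \in v :: u by rewrite (perm_mem (pass_perm _ _ _ _ (pass_pre_pass _ _ _ _ mem))) mem_head.
by rewrite inE => /orP[/eqP->//|/(allP (IHu _ mem)) /ltnW].
Qed.

(** The row that fired last, ending in v, is undone first. Let u lie below v and [vs]. If v is a
    right-to-left minimum, every undoing is allowed and [sum_record_pairs_fst] gives the recurrence;
    otherwise only the undoing that changes nothing is. *)
Lemma size_net_pre vs u : uniq (vs ++ u) -> 0 \notin vs ++ u ->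
  size (net_pre vs u) =
  if allrel ltn u vs then polyBernoulliB (records 0 u) (minima vs) else 0.
Proof.
elim: vs u => [|v vs IHvs] u; first by rewrite allrel0r polyBernoulliB0.
rewrite [(v :: vs) ++ u]/= => /= /andP[nv Uvu]; rewrite inE negb_or => /andP[v0 nvu0].
have -> : size (flatten [seq [seq (z.1 :: y.1, y.2) | y <- net_pre vs z.2] | z <- pass_pre u v])
  = \sum_(z <- pass_pre u v) size (net_pre vs z.2).
  elim: (pass_pre u v) => [|z l IHl]; first by rewrite big_nil.
  by rewrite big_cons /= size_cat size_map IHl.
have [nvvs nvu] : v \notin vs /\ v \notin u by apply/andP; rewrite -negb_or -mem_cat.
have [nvs0 nu0] : 0 \notin vs /\ 0 \notin u by apply/andP; rewrite -negb_or -mem_cat.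
have [Uvs Uu] : uniq vs /\ uniq u by move: Uvu; rewrite cat_uniq => /and3P[].
rewrite allrel_consr; have [ltuv|nltuv] /= := boolP (all (ltn^~ v) u); last first.
  rewrite big1_seq // => z /andP[_ /pass_pre_lt ltuv].
  by rewrite ltuv in nltuv.
have IH z : z \in pass_pre u v -> size (net_pre vs z.2) =
    if allrel ltn z.2 vs then polyBernoulliB (records 0 z.2) (minima vs) else 0.
  case: z => a w /pass_pre_pass/pass_perm P.
  have P' : perm_eq (v :: vs ++ u) (a :: vs ++ w).
    rewrite -[v :: _]/([:: v] ++ vs ++ u) -[a :: _]/([:: a] ++ vs ++ w).
    by rewrite perm_catCA perm_sym perm_catCA perm_sym perm_cat2l.
  apply: IHvs => /=.
    by move: (perm_uniq P'); rewrite /= nv Uvu => /esym/andP[].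
  have : 0 \notin a :: vs ++ w by rewrite -(perm_mem P') inE negb_or v0.
  by rewrite inE negb_or => /andP[].
have memE z : z \in pass_pre u v -> v \in z.1 :: z.2 /\ {subset u <= z.1 :: z.2}
    /\ {subset z.1 :: z.2 <= v :: u}.
  case: z => a w /pass_pre_pass/pass_perm/perm_mem P.
  split; first by rewrite -P mem_head.
  by split=> x; rewrite -P // inE => ->; rewrite orbT.
(* An entry e of u not below some x of [vs] stays on a column unless it was the row's input; in that
   case v was on a column, and v > e is not below x either. *)
have [ltuvs|nltuvs] := boolP (allrel ltn u vs); last first.
  rewrite big1_seq // => z /andP[_ memz]; rewrite IH //; case: ifP => // ltzvs.
  case/negP: nltuvs; apply/allrelP => e x memu memx.
  have [memv [subu _]] := memE _ memz.
  have /subu := memu; rewrite inE => /orP[/eqP ez|memz2]; last exact: (allrelP ltzvs).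
  apply: (@ltn_trans v); first exact: (allP ltuv).
  apply: (allrelP ltzvs) => //; move: memv; rewrite inE => /orP[/eqP vz|//].
  by move: nvu; rewrite vz -ez memu.
have [ltvvs|nltvvs] := boolP (all (ltn v) vs).
  rewrite add1n polyBernoulliB_rec.
  rewrite -(sum_record_pairs_fst (records 0 u) (fun l => polyBernoulliB l (minima vs))).
  (* Labels are positive, so the threshold 0 keeps every preimage. *)
  rewrite -(record_pairs_pre u v 0) ?lt0n 1?eq_sym // big_map /= big_filter.
  rewrite big_seq [RHS]big_seq_cond; apply: eq_big => [z|z memz].
    case memz: (z \in _) => //=; have [_ [_ sub]] := memE _ memz.
    have /sub := mem_head z.1 z.2; rewrite lt0n => mem1; apply/esym.
    by apply: contraTneq mem1 => ->; rewrite inE negb_or v0.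
  rewrite IH // ifT //; apply/allrelP => e x meme memx.
  have [_ [_ sub]] := memE _ memz.
  have : e \in z.1 :: z.2 by rewrite inE meme orbT.
  move/sub; rewrite inE => /orP[/eqP->|memu]; first exact: (allP ltvvs).
  exact: (allrelP ltuvs).
(* Some x of [vs] lies below v, so v cannot be on a column. It is then the row's input and, being
   the largest label met, leaves the columns unchanged. *)
rewrite add0n (bigD1_seq (v, u)) ?pass_pre_uniq ?pass_pre_id //=.
have /= -> := IH _ (pass_pre_id u v ltuv Uu); rewrite ltuvs.
rewrite big1_seq ?addn0 // => z /andP[nz memz]; rewrite IH //.
case: ifP => // ltzvs; case/negP: nltvvs; apply/allP => x memx /=.
apply: (allrelP ltzvs) => //; have [+ _] := memE _ memz.
rewrite inE => /orP[/eqP vz|//]; case/negP: nz; move: vz memz.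
case: z ltzvs => a w /= _ <- {a} /pass_pre_pass E; apply/eqP; congr pair.
have := pass_perm _ _ _ _ E; rewrite perm_cons => /perm_mem P.
move: E; rewrite pass_max; first by case.
by apply/allP => y; rewrite -P => /(allP ltuv).
Qed.

Lemma lr_maxima_records s : uniq s -> 0 \notin s -> lr_maxima s = records 0 s.
Proof.
move=> Us n0.
(* Generalised over a threshold t, since the head of the word may become the threshold for its
   tail. *)
have gen t : uniq s -> t \notin s ->
    count (fun j => (t < nth 0 s j) && all (fun x => x <= nth 0 s j) (take j s))
      (iota 0 (size s)) = records t s.
  elim: s t {Us n0} => //= b s IHs t /andP[nb Us]; rewrite inE negb_or => /andP[nt nts].
  rewrite andbT (iotaDl 1 0) count_map.
  case: ltnP => ltb; [rewrite -(IHs b) // add1n; congr S | rewrite -(IHs t) // add0n];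
    apply: eq_in_count => j; rewrite mem_iota /= add0n => ltj.
    have nbj : b != nth 0 s j by apply: contraNneq nb => ->; rewrite mem_nth.
    by rewrite /= add0n; case: all; rewrite ?andbF //; lia.
  by rewrite /= add0n; case: all; rewrite ?andbF //; lia.
rewrite -gen //; apply: eq_in_count => j; rewrite mem_iota add0n => ltj.
by rewrite lt0n; case: eqP => // n0j; rewrite -n0j mem_nth in n0.
Qed.

Lemma rl_minima_minima s : uniq s -> rl_minima s = minima s.
Proof.
rewrite /rl_minima; elim: s => //= v s IHs /andP[nv Us].
rewrite -IHs // (iotaDl 1 0) count_map drop0; congr (_ + _); last first.
congr nat_of_bool; apply: eq_in_all => x memx /=.
by rewrite ltn_neqAle; case: eqP => // vx; rewrite vx memx in nv.
Qed.

(** * Toppling performs the passes *)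

Lemma chip_subproof m l : l.-1 %% (m + 1) < m + 1.
Proof. by rewrite ltn_pmod ?addn1. Qed.

(** Label l has index l - 1; the remainder makes the function total. *)
Definition chip m l : 'I_(m + 1) := Ordinal (chip_subproof m l).

Definition label m : pred nat := fun l => 0 < l <= m + 1.

Lemma chipE m l : label m l -> (chip m l).+1 = l.
Proof. by case: l => // l /andP[_ ltl]; rewrite /= modn_small. Qed.

Lemma chipK m (k : 'I_(m + 1)) : chip m k.+1 = k.
Proof. by apply: val_inj; rewrite /= modn_small. Qed.

Lemma chip_inj m : {in label m &, injective (chip m)}.
Proof. by move=> k l /chipE {2}<- /chipE {2}<- ->. Qed.

Fixpoint chain (f : nat -> int) (s : int) (w : seq nat) : bool :=
  if w is a :: w' then (f a == s) && chain f (s + 1)%R w' else true.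

Lemma eq_in_chain f g s w : {in w, f =1 g} -> chain f s w = chain g s w.
Proof.
elim: w s => //= a w IHw s eqfg; rewrite eqfg ?mem_head // IHw // => x memx.
by rewrite eqfg // inE memx orbT.
Qed.

Lemma topple_reach_trans m (c c' c'' : lconf m) :
  topple_reach c c' -> topple_reach c' c'' -> topple_reach c c''.
Proof.
elim=> {c c'} [c c' /funext-> //|c c1 c' st _ IH] /IH.
exact: reach_step.
Qed.

Lemma topple_labels m (c : lconf m) i k l : label m k -> label m l -> k != l ->
  c (chip m k) = i -> c (chip m l) = i ->
  exists2 c', topple_reach c c' & {in label m, forall x, c' (chip m x) =
    (if x == minn k l then i - 1 else if x == maxn k l then i + 1 else c (chip m x))%R}.
Proof.
wlog ltkl : k l / k < l => [H|] labk labl nkl ck cl.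
  have [lt|lt] : k < l \/ l < k by lia.
    exact: H.
  by have [|c' r E] := H l k lt labl labk _ cl ck; [lia | exists c'; rewrite // minnC maxnC].
rewrite (minn_idPl (ltnW ltkl)) (maxn_idPr (ltnW ltkl)).
exists (fun x => if x == chip m k then i - 1 else if x == chip m l then i + 1 else c x)%R.
  apply: reach_step (reach_refl (fun=> erefl _)).
  exists i, (chip m k), (chip m l); split=> //.
  by rewrite -ltnS !chipE.
move=> x labx /=.
have E y : label m y -> (chip m x == chip m y) = (x == y).
  by move=> laby; apply/eqP/eqP => [/chip_inj->|->].
by rewrite !E.
Qed.

(** The row chip shares site s with the first column. Firing s drops the smaller label to s - 1 and
    sends the larger one to s + 1, where the next column waits; so each column moves one step
    left. *)
Lemma pass_topple m (c : lconf m) s a w u v :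
  all (label m) (a :: w) -> uniq (a :: w) -> pass a w = (u, v) ->
  c (chip m a) = s -> chain (c \o chip m) s w ->
  exists c', [/\ topple_reach c c', chain (c' \o chip m) (s - 1)%R u,
    c' (chip m v) = (s + (size w)%:Z)%R
    & {in label m, forall x, x \notin a :: w -> c' (chip m x) = c (chip m x)}].
Proof.
elim: w c s a u v => [|b w IHw] c s a u v.
  move=> _ _ [<- <-] ca _; exists c; split=> //; last by rewrite addr0.
  exact: reach_refl.
move=> /= /and3P[laba labb labw]; rewrite inE negb_or => /andP[/andP[nab naw] /andP[nbw Uw]].
case E: (pass _ w) => [u' v'] [<- <-] ca /andP[/eqP cb chw].
have [c1 r1 c1E] := topple_labels _ _ _ _ _ laba labb nab ca cb.
have nminw : minn a b \notin w by case: leqP.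
have nmaxw : maxn a b \notin w by case: leqP.
have labmin : label m (minn a b) by case: leqP.
have labmax : label m (maxn a b) by case: leqP.
have nminmax : minn a b != maxn a b by move: nab; clear; lia.
have c1w x : x \in w -> c1 (chip m x) = c (chip m x).
  move=> memx; rewrite c1E; last exact: (allP labw).
  by rewrite !ifN //; apply: contraTneq memx => ->.
have [||||c' [r' ch' cv' keep]] := IHw c1 (s + 1)%R _ _ _ _ _ E.
- by rewrite /= labmax.
- by rewrite /= nmaxw.
- by rewrite c1E // eq_sym (negbTE nminmax) eqxx.
- by rewrite (@eq_in_chain _ (c \o chip m)) // => x /c1w.
exists c'; split.
- exact: topple_reach_trans r1 r'.
- rewrite /= keep ?c1E ?eqxx //=; last by rewrite inE negb_or nminmax.
  by move: ch'; rewrite addrK subrK.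
- by rewrite cv' -addrA.
move=> x labx; rewrite !inE !negb_or => /and3P[nxa nxb nxw].
rewrite keep //; last by rewrite inE negb_or nxw andbT; move: nxa nxb; clear; lia.
by rewrite c1E // !ifN //; move: nxa nxb; clear; lia.
Qed.

(** The rows to the right of the head row fire first, each shifting the columns one site left, so
    that the first column reaches s just when the head row must fire. The last clause shows that the
    head row has waited there. *)
Lemma net_topple m (c : lconf m) s R w vs u :
  all (label m) (R ++ w) -> uniq (R ++ w) -> net R w = (vs, u) ->
  chain (c \o chip m) s R -> chain (c \o chip m) (s + (size R)%:Z - 1)%R w ->
  exists c', [/\ topple_reach c c', chain (c' \o chip m) (s - 1)%R u,
    chain (c' \o chip m) (s + (size w)%:Z)%R vs
    & {in label m, forall x, x \notin R ++ w -> c' (chip m x) = c (chip m x)}].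
Proof.
elim: R c s vs u => [|a R IHR] c s vs u.
  move=> _ _ [<- <-] _ chw; exists c; split=> //; first exact: reach_refl.
  by move: chw; rewrite addr0.
move=> /= /andP[laba labRw] /andP[naRw URw].
case E: (net R w) => [vs1 w1]; case F: (pass a w1) => [u1 v1] [<- <-].
move=> /andP[/eqP ca chR] chw.
have [|c1 [r1 chw1 chvs1 keep1]] := IHR c (s + 1)%R _ _ labRw URw E chR.
  by move: chw; congr chain; clear; lia.
have P := net_perm _ _ _ _ E; have [_ sw1] := net_size _ _ _ _ E.
have memw1 x : x \in w1 -> x \in R ++ w by rewrite -(perm_mem P) mem_cat orbC => ->.
have labw1 : all (label m) w1 by apply/allP => x /memw1; apply: (allP labRw).
have Uvw1 : uniq (vs1 ++ w1) by rewrite (perm_uniq P).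
have [||||c' [r' ch' cv' keep]] := pass_topple m c1 s _ _ _ _ _ _ F.
- by rewrite /= laba.
- rewrite /= (contra (@memw1 a)) //=.
  by move: Uvw1; rewrite cat_uniq => /and3P[].
- by rewrite keep1.
- by move: chw1; rewrite addrK.
exists c'; split=> //.
- exact: topple_reach_trans r1 r'.
- rewrite /= cv' sw1 eqxx /=.
  have -> : (s + (size w)%:Z + 1 = s + 1 + (size w)%:Z)%R by rewrite addrAC.
  rewrite (@eq_in_chain _ (c1 \o chip m)) // => x memx /=.
  have memRw : x \in R ++ w by rewrite -(perm_mem P) mem_cat memx.
  rewrite keep //; first exact: (allP labRw).
  rewrite inE negb_or; apply/andP; split; first by apply: contraNneq naRw => <-.
  move: Uvw1; rewrite cat_uniq => /and3P[_ /hasPn H _].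
  by apply/negP => /H; rewrite /= memx.
move=> x labx; rewrite inE negb_or => /andP[nxa nxRw].
rewrite keep ?keep1 // inE negb_or nxa /=.
by apply: contra nxRw => /memw1.
Qed.

(** * Confluence of toppling *)

Definition occupancy m (c : lconf m) (s : int) : nat := \sum_k (c k == s).

(* In any reachable configuration two doubled sites are separated by an empty one;
   this is what keeps a third chip from arriving at a doubled site. *)
Definition alternating m (c : lconf m) : Prop :=
  (forall s, occupancy m c s <= 2) /\
  forall s t, (s < t)%R -> occupancy m c s = 2 -> occupancy m c t = 2 ->
    exists2 r, (s < r < t)%R & occupancy m c r = 0.

Lemma occupancy_step m (c c' : lconf m) i (a b : 'I_(m + 1)) s :
  (a < b)%N -> c a = i -> c b = i ->
  (forall k, c' k = (if k == a then i - 1 else if k == b then i + 1 else c k)%R) ->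
  occupancy m c' s + 2 * (s == i) = occupancy m c s + (s == i - 1)%R + (s == i + 1)%R.
Proof.
move=> ltab ca cb E; have nab : b != a by rewrite neq_ltn ltab orbT.
rewrite /occupancy (bigD1 a) // [X in _ = X + _ + _](bigD1 a) //=.
rewrite (bigD1 b) // [X in _ = _ + X + _ + _](bigD1 b) //=.
rewrite !E !eqxx (negbTE nab) ca cb !(eq_sym s).
rewrite (eq_bigr (fun k => c k == s : nat)); first by lia.
by move=> k /andP[/negbTE nka /negbTE nkb]; rewrite E nka nkb.
Qed.

Lemma occupancy_pair m (c : lconf m) s (a b : 'I_(m + 1)) : a != b ->
  c a = s -> c b = s -> occupancy m c s = 2 + \sum_(k | (k != a) && (k != b)) (c k == s).
Proof.
move=> nab ca cb; rewrite /occupancy (bigD1 a) // (bigD1 b) 1?eq_sym //=.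
by rewrite ca cb eqxx addnA.
Qed.

Lemma alternating_step m (c c' : lconf m) :
  topple_step c c' -> alternating m c -> alternating m c'.
Proof.
move=> [i [a [b [ltab [ca [cb E]]]]]] [le2 zero].
have nab : a != b by rewrite neq_ltn ltab.
have occ s := occupancy_step _ _ _ _ _ _ s ltab ca cb E.
have occi : occupancy m c i = 2.
  by apply/eqP; rewrite eqn_leq le2 (occupancy_pair _ _ _ _ _ nab ca cb) leq_addr.
(* Adjacent doubled sites would leave no room for an empty site between them. *)
have left1 : occupancy m c (i - 1)%R <= 1.
  rewrite leqNgt; apply/negP => gt1.
  have [||r lt_r _] := zero (i - 1)%R i _ _ occi; [lia| |lia].
  by have := le2 (i - 1)%R; lia.
have right1 : occupancy m c (i + 1)%R <= 1.
  rewrite leqNgt; apply/negP => gt1.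
  have [||r lt_r _] := zero i (i + 1)%R _ occi; [lia| |lia].
  by have := le2 (i + 1)%R; lia.
split=> [s|s t ltst occs occt].
  have := occ s; have := le2 s.
  have [->|nl] := eqVneq s (i - 1)%R; first lia.
  have [->|nr] := eqVneq s (i + 1)%R; first lia.
  lia.
have nsi : s != i by apply/eqP => ei; move: (occ s) occs; rewrite ei; lia.
have nti : t != i by apply/eqP => ei; move: (occ t) occt; rewrite ei; lia.
have occi0 : occupancy m c' i = 0 by move: (occ i); lia.
have [lti|leti] := boolP (t < i)%R; last first.
  have [ltis|leis] := boolP (i < s)%R; last by exists i => //; lia.
  have occt2 : occupancy m c t = 2 by move: (occ t); lia.
  (* A newly doubled i + 1 takes over the gap of i: the empty site between i and t is not i + 1,
     which held one chip. *)
  have [es|ns] := eqVneq s (i + 1)%R.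
    have [|r ltr r0] := zero i t _ occi occt2; first lia.
    have nr : r != (i + 1)%R by apply/eqP => er; move: (occ s) r0; rewrite er -es; lia.
    by exists r; [lia | move: (occ r); lia].
  have occs2 : occupancy m c s = 2 by move: (occ s); lia.
  have [//|r ltr r0] := zero s t _ occs2 occt2.
  by exists r; [lia | move: (occ r); lia].
have occs2 : occupancy m c s = 2 by move: (occ s); lia.
have [et|nt] := eqVneq t (i - 1)%R.
  have [|r ltr r0] := zero s i _ occs2 occi; first lia.
  have nr : r != (i - 1)%R by apply/eqP => er; move: (occ t) r0; rewrite er -et; lia.
  by exists r; [lia | move: (occ r); lia].
have occt2 : occupancy m c t = 2 by move: (occ t); lia.
have [//|r ltr r0] := zero s t _ occs2 occt2.
by exists r; [lia | move: (occ r); lia].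
Qed.

(** A firing site holds just two chips, so its firing is determined; firings at different sites
    involve disjoint chips and commute. *)
Lemma topple_diamond m (c c1 c2 : lconf m) : alternating m c ->
  topple_step c c1 -> topple_step c c2 ->
  c1 = c2 \/ exists2 d, topple_step c1 d & topple_step c2 d.
Proof.
move=> [le2 _] [i [a [b [ltab [ca [cb E1]]]]]] [j [a' [b' [ltab' [ca' [cb' E2]]]]]].
have nab : a != b by rewrite neq_ltn ltab.
have nab' : a' != b' by rewrite neq_ltn ltab'.
have [eij|nij] := eqVneq i j.
  left; have mem k : c k = i -> (k == a) || (k == b).
    move=> ck; rewrite -[_ || _]negbK negb_or; apply/negP => nk.
    have := le2 i; rewrite (occupancy_pair _ _ _ _ _ nab ca cb) (bigD1 k) //= ck eqxx.
    by lia.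
  have := mem _ (etrans ca' (esym eij)); have := mem _ (etrans cb' (esym eij)).
  move=> /orP[]/eqP eb /orP[]/eqP ea; subst a' b'; rewrite ?eqxx // in nab'.
    by move: (ltn_trans ltab ltab'); rewrite ltnn.
  by apply/funext => k; rewrite E1 E2 eij.
right.
have ne x y s t : s != t -> c x = s -> c y = t -> (y == x) = false.
  by move=> nst cx cy; apply/eqP => exy; move: nst; rewrite -cx -cy exy eqxx.
have naa := ne _ _ _ _ nij ca ca'; have nba := ne _ _ _ _ nij cb ca'.
have nab1 := ne _ _ _ _ nij ca cb'; have nbb := ne _ _ _ _ nij cb cb'.
exists (fun k => if k == a' then j - 1 else if k == b' then j + 1 else c1 k)%R.
  by exists j, a', b'; rewrite !E1 naa nba nab1 nbb.
exists i, a, b; split=> //.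
rewrite !E2 ![a == _]eq_sym ![b == _]eq_sym naa nba nab1 nbb; split=> //; split=> // k.
rewrite E1 E2; have [->|nka'] := eqVneq k a'; first by rewrite naa nba.
by have [->|nkb'] := eqVneq k b'; first by rewrite nab1 nbb.
Qed.

Lemma stable_no_step m (c c' : lconf m) : stable c -> ~ topple_step c c'.
Proof.
move=> st [i [a [b [ltab [ca [cb _]]]]]].
by move: ltab; rewrite (st a b) ?ltnn // ca.
Qed.

(** Induction along the path to s: by the diamond, the step to [c1] either is the first step of the
    path or moves past it. *)
Lemma reach_after_step m (c c1 s : lconf m) : alternating m c ->
  topple_reach c s -> stable s -> topple_step c c1 -> topple_reach c1 s.
Proof.
move=> alt r st; elim: r c1 alt st => {c s} [c c' /funext-> c1 _ /stable_no_step H /H//|].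
move=> c c2 s st2 r2 IH c1 alt sts st1.
have [->//|[d d1 d2]] := topple_diamond _ _ _ _ alt st1 st2.
apply: reach_step d1 _; apply: IH d2 => //.
exact: alternating_step st2 alt.
Qed.

Lemma stable_reach_uniq m (c s s' : lconf m) : alternating m c ->
  topple_reach c s -> stable s -> topple_reach c s' -> stable s' -> s = s'.
Proof.
move=> + r; elim: r => {c s} [c c' /funext->|c c1 s st1 _ IH] alt sts r' sts'.
  case: r' sts => [? ? /funext-> //|? ? ? st _ /stable_no_step/(_ st)//].
apply: IH => //; first exact: alternating_step st1 alt.
exact: reach_after_step st1.
Qed.

(** * Readings, starting sites and grid inputs *)

Lemma map_chip_iota m : map (chip m) (iota 1 (m + 1)) = enum 'I_(m + 1).
Proof.
rewrite (iotaDl 1 0) -val_enum_ord -2!map_comp -[RHS]map_id.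
by apply: eq_map => k; rewrite -[RHS]chipK.
Qed.

Lemma perm_map_chip m w :
  perm_eq w (iota 1 (m + 1)) -> perm_eq (map (chip m) w) (enum 'I_(m + 1)).
Proof. by rewrite -map_chip_iota; apply: perm_map. Qed.

Lemma label_perm m w : perm_eq w (iota 1 (m + 1)) -> all (label m) w.
Proof.
by move=> P; apply/allP => x; rewrite (perm_mem P) mem_iota /label; lia.
Qed.

(** Strict increase along w makes c injective, so the sorted order of the chips is unique. *)
Lemma reading_sorted m (c : lconf m) w : perm_eq w (iota 1 (m + 1)) ->
  sorted (fun x y => c (chip m x) < c (chip m y))%R w -> stable c /\ reading c = w.
Proof.
move=> P sw; have Pe := perm_map_chip _ _ P.
have inj : injective c.
  apply/injectiveP; rewrite /injectiveb /dinjectiveb.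
  have /perm_uniq <- := perm_map c Pe.
  apply: (@sorted_uniq _ <%R%O lt_trans ltxx).
  by rewrite -map_comp sorted_map.
split; first exact: inj.
rewrite /reading; have -> : sort (fun a b => (c a <= c b)%R) (enum 'I_(m + 1)) = map (chip m) w.
  apply: (@sorted_eq _ (fun a b => (c a <= c b)%R)).
  - by move=> x y z; apply: le_trans.
  - by move=> x y /le_anti /inj.
  - by apply: sort_sorted => x y; apply: le_total.
  - rewrite sorted_map; apply: sub_sorted sw => x y /=; exact: ltW.
  by rewrite perm_sort perm_sym.
rewrite -map_comp -[RHS]map_id; apply/eq_in_map => x memx /=.
by rewrite chipE // (allP (label_perm _ _ P)).
Qed.

Lemma chain_path f s x w : (f x < s)%R -> chain f s w ->
  path (fun a b => f a < f b)%R x w.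
Proof.
elim: w s x => //= a w IHw s x ltxs /andP[/eqP fa chw].
by rewrite fa ltxs (IHw (s + 1)%R) // fa; lia.
Qed.

Lemma chain_iota g s w : chain (fun l => Posz (g l)) (Posz s) w = (map g w == iota s (size w)).
Proof.
elim: w s => //= a w IHw s; rewrite eqseq_cons -IHw.
by congr (_ && chain _ _ _); lia.
Qed.

(** Rows start on 1..p and columns on p..m; the doubled site p ends the first run and opens the
    second. *)
Definition start_sites m p : seq nat := iota 1 p ++ iota p (m + 1 - p).

Lemma count_start_sites m p s : 0 < p <= m -> count_mem s (start_sites m p) =
  if (1 <= s <= m) then (if s == p then 2 else 1) else 0.
Proof.
move=> lep; rewrite /start_sites count_cat !count_uniq_mem ?iota_uniq // !mem_iota.
by case: ifP => [|]; try case: ifP; lia.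
Qed.

Lemma count_sites m (c : iconf m) (s : 'I_(m + 2)) :
  count_mem (s : nat) [seq c k : nat | k <- enum 'I_(m + 1)] = #|[set k | c k == s]|.
Proof. by rewrite count_map cardsE cardE size_filter -enumT; apply: eq_count. Qed.

Lemma in_SE m p (c : iconf m) : 0 < p <= m ->
  in_S m p c = perm_eq [seq c k : nat | k <- enum 'I_(m + 1)] (start_sites m p).
Proof.
move=> lep; apply/forallP/idP => [S|P s]; last first.
  by rewrite -count_sites (permP P) count_start_sites.
apply/allP => s _ /=; rewrite count_start_sites //.
have [lts|les] := ltnP s (m + 2).
  by have := S (Ordinal lts); rewrite -count_sites.
rewrite ifN; last by lia.
apply/eqP/count_memPn; apply/negP => /mapP[k _ sk]; have := ltn_ord (c k).
by rewrite -sk ltnNge les.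
Qed.

(** No site but p is doubled, so the separation condition is vacuous. *)
Lemma alternating_in_S m p (c : iconf m) : in_S m p c -> alternating m (as_lconf c).
Proof.
move=> /forallP S.
have occE (s : 'I_(m + 2)) : occupancy m (as_lconf c) (Posz s) =
    if (1 <= s <= m) then (if nat_of_ord s == p then 2 else 1) else 0.
  rewrite -(eqP (S s)) cardsE -sum1_card /occupancy [RHS]big_mkcond /=.
  by apply: eq_bigr => k _.
have occN (s : int) : (forall t : 'I_(m + 2), s != Posz t) -> occupancy m (as_lconf c) s = 0.
  by move=> ns; rewrite /occupancy big1 // => k _; rewrite eq_sym (negbTE (ns _)).
have occ s : occupancy m (as_lconf c) s <= 2 /\
    (occupancy m (as_lconf c) s = 2 -> s = Posz p).
  have [[t ->]|ns] := EM (exists t : 'I_(m + 2), s = Posz t); last first.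
    by rewrite occN // => t; apply/eqP => st; apply: ns; exists t.
  by rewrite occE; case: ifP => // _; case: eqP => // ->.
split=> [s|s t ltst /(occ s).2 sp /(occ t).2 tp]; first exact: (occ s).1.
by move: ltst; rewrite sp tp ltxx.
Qed.

(** Presents c as an input of the grid, with rows [z.1] and columns [z.2]. Which chip of p is the
    row is left free. *)
Definition word_of m p (c : iconf m) (z : seq nat * seq nat) : bool :=
  [&& size z.1 == p, perm_eq (z.1 ++ z.2) (iota 1 (m + 1)) &
      [seq c (chip m l) : nat | l <- z.1 ++ z.2] == start_sites m p].

Lemma word_of_in_S m p (c : iconf m) z : 0 < p <= m -> word_of m p c z -> in_S m p c.
Proof.
move=> lep /and3P[_ P /eqP E]; rewrite in_SE // -E.
by rewrite (map_comp (fun k => c k : nat) (chip m)) perm_map // perm_sym perm_map_chip.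
Qed.

(** The columns end on sites 0..m - p and the rows on m + 2 - p..m + 1, so the reading is columns,
    then rows. Confluence excludes any other result. *)
Lemma topples_to_word m p (c : iconf m) z vs u pi : 0 < p <= m ->
  word_of m p c z -> net z.1 z.2 = (vs, u) ->
  topples_to (as_lconf c) pi <-> pi = u ++ vs.
Proof.
move=> lep wc; have Sc := word_of_in_S _ _ _ _ lep wc.
case: z wc => R w; rewrite /word_of /= => /and3P[/eqP sR P E] F.
have sw : size w = m + 1 - p.
  by have := perm_size P; rewrite size_cat size_iota sR => <-; rewrite addKn.
have [chR chw] : chain (as_lconf c \o chip m) (Posz 1) R /\ chain (as_lconf c \o chip m) (Posz p) w.
  move: E; rewrite map_cat eqseq_cat ?size_map ?size_iota // => /andP[ER Ew].
  split; first by rewrite -sR -chain_iota in ER.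
  by rewrite -sw -chain_iota in Ew.
have [||c' [r chu chvs _]] := net_topple _ _ _ _ _ _ _ (label_perm _ _ P) _ F chR.
- by rewrite (perm_uniq P) iota_uniq.
- by move: chw; congr chain; rewrite sR; lia.
have [svs su] := net_size _ _ _ _ F.
have P' : perm_eq (u ++ vs) (iota 1 (m + 1)).
  by apply: perm_trans P; rewrite perm_catC; apply: net_perm F.
have [] := reading_sorted _ c' _ P'.
  have u0 : 0 < size u by rewrite su sw; lia.
  have chu' : chain (c' \o chip m) 0%R u by move: chu; congr chain.
  case: u u0 chu' {chu F P'} su => // x u _ /= /andP[/eqP c'x chu] su.
  rewrite cat_path (@chain_path _ _ _ _ _ chu) /= ?c'x //.
  apply: chain_path chvs.
  suff last_u : (c' (chip m (last x u)) = (size u)%:Z)%R by rewrite /= last_u -su /=; clear; lia.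
  have : forall s, c' (chip m x) = s -> chain (c' \o chip m) (s + 1)%R u ->
     c' (chip m (last x u)) = (s + (size u)%:Z)%R.
    elim: u x {c'x chu su} => [|y u IHu] x s /= <-; first by rewrite addr0.
    by move=> /andP[/eqP c'y] /(IHu _ _ c'y) ->; lia.
  by move/(_ _ c'x chu); rewrite add0r.
move=> stc' rdc'; split=> [[c1 [r1 [st1 <-]]]|->]; last by exists c'.
by rewrite -rdc' (stable_reach_uniq _ _ _ _ (alternating_in_S _ _ _ Sc) r stc' r1 st1).
Qed.

(** [reading] lists the chips by site even when c is not stable; this list, cut after p chips, is a
    word. *)
Lemma word_of_exists m p (c : iconf m) : 0 < p <= m -> in_S m p c ->
  exists z, word_of m p c z.
Proof.
move=> lep Sc; pose w := reading (as_lconf c).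
have P : perm_eq w (iota 1 (m + 1)).
  rewrite /w /reading (iotaDl 1 0) -val_enum_ord -map_comp.
  by apply: perm_map; rewrite perm_sort.
have E : [seq c (chip m l) : nat | l <- w] = start_sites m p.
  rewrite /w /reading -map_comp (eq_map (_ : _ =1 (fun k => c k : nat))); last first.
    by move=> k /=; rewrite chipK.
  apply: (sorted_eq leq_trans anti_leq).
  - have tot : total (fun a b => (as_lconf c a <= as_lconf c b)%R).
      by move=> x y; apply: le_total.
    by rewrite sorted_map; apply: sub_sorted (sort_sorted tot _) => x y; rewrite lez_nat.
  - rewrite (sorted_pairwise leq_trans) pairwise_cat -!(sorted_pairwise leq_trans).
    rewrite !iota_sorted !andbT; apply/allrelP => x y; rewrite !mem_iota.
    by clear; lia.
  rewrite -(permPr (_ : perm_eq [seq c k : nat | k <- enum 'I_(m + 1)] _)); last by rewrite -in_SE.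
  by apply: perm_map; rewrite perm_sort.
exists (take p w, drop p w).
rewrite /word_of /= cat_take_drop P E eqxx !andbT size_take (perm_size P) size_iota.
by move: lep; clear; case: ifP; lia.
Qed.

Lemma word_of_split m p (c : iconf m) z : 0 < p <= m -> word_of m p c z ->
  exists R a b w, [/\ z = (rcons R a, b :: w),
    [seq c (chip m l) : nat | l <- R] = iota 1 p.-1,
    c (chip m a) = p :> nat, c (chip m b) = p :> nat &
    [seq c (chip m l) : nat | l <- w] = iota p.+1 (m - p)].
Proof.
case: z => R w /andP[p0 lepm]; rewrite /word_of /= => /and3P[/eqP sR P].
rewrite map_cat eqseq_cat ?size_map ?size_iota //.
have -> : m + 1 - p = (m - p).+1 by rewrite addn1 subSn.
have -> : iota 1 p = rcons (iota 1 p.-1) p.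
  by rewrite -{1}(prednK p0) -(addn1 p.-1) iotaD cats1 add1n prednK.
case: w P => [|b w] P /andP[] //=; case/lastP: R sR P => [|R a] sR P.
  by rewrite -sR in p0.
rewrite map_rcons eqseq_rcons eqseq_cons => /andP[/eqP ER /eqP Ea] /andP[/eqP Eb /eqP Ew].
by exists R, a, b, w.
Qed.

(** * The two words of a configuration and the final count *)

Lemma in_S_inj m p (c : iconf m) k l : in_S m p c -> c k = c l -> (c k != p :> nat) -> k = l.
Proof.
move=> /forallP/(_ (c k))/eqP card ckl nkp.
have /card_le1_eqP : #|[set x | c x == c k]| <= 1.
  by rewrite card (negbTE nkp); case: ifP.
by apply; rewrite inE // ckl.
Qed.

Lemma perm_pair (a b a' b' : nat) : perm_eq [:: a; b] [:: a'; b'] ->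
  (a = a' /\ b = b') \/ (a = b' /\ b = a').
Proof.
move=> P; have := perm_mem P a; rewrite !inE eqxx /= => /esym/orP[]/eqP ea; subst a.
  by move: P; rewrite perm_cons => /perm_mem/(_ b); rewrite !inE eqxx => /esym/eqP; left.
have : perm_eq [:: b'; b] [:: b'; a'] by rewrite (permPl P) (perm_catC [:: a'] [:: b']).
by rewrite perm_cons => /perm_mem/(_ b); rewrite !inE eqxx => /esym/eqP; right.
Qed.

Lemma map_site_inj m p (c : iconf m) s t : in_S m p c ->
  all (label m) s -> all (label m) t -> p \notin [seq c (chip m l) : nat | l <- s] ->
  [seq c (chip m l) : nat | l <- s] = [seq c (chip m l) : nat | l <- t] -> s = t.
Proof.
move=> Sc; elim: s t => [|k s IHs] [|l t] //= /andP[labk labs] /andP[labl labt].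
rewrite inE negb_or => /andP[nkp nps] [/val_inj ekl /(IHs _ labs labt nps) ->].
congr cons; apply: (chip_inj m) => //; apply: in_S_inj Sc ekl _.
by rewrite eq_sym.
Qed.

(** Every site but p holds at most one chip, so the word is forced there; the only freedom is to
    exchange the last row with the first column. *)
Lemma word_of_two m p (c : iconf m) : 0 < p <= m -> in_S m p c ->
  exists z1 z2, z1 != z2 /\ forall z, word_of m p c z = (z \in [:: z1; z2]).
Proof.
move=> lep Sc; have [z0 wz0] := word_of_exists _ _ _ lep Sc.
have [R [a [b [w [ez0 ER Ea Eb Ew]]]]] := word_of_split _ _ _ _ lep wz0.
subst z0; exists (rcons R a, b :: w), (rcons R b, a :: w).
have P0 : perm_eq (R ++ a :: b :: w) (iota 1 (m + 1)).
  by case/and3P: wz0; rewrite /= cat_rcons.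
have nab : a != b.
  have := perm_uniq P0; rewrite iota_uniq cat_uniq => /and3P[_ _ /=].
  by rewrite inE negb_or -andbA => /andP[].
split; first by rewrite xpair_eqE eqseq_cons eq_sym [b == a]eq_sym (negbTE nab) andbF.
case=> R' w'; apply/idP/idP => [wz|]; last first.
  rewrite !inE => /orP[]/eqP-> //; move: wz0.
  rewrite /word_of /= !size_rcons !cat_rcons !map_cat /= Ea Eb => /and3P[-> P ->].
  rewrite andbT; apply: perm_trans P; rewrite perm_cat2l.
  by rewrite (perm_catCA [:: b] [:: a] w).
have [R1 [a1 [b1 [w1 [ez ER1 Ea1 Eb1 Ew1]]]]] := word_of_split _ _ _ _ lep wz.
move: wz; rewrite ez /word_of /= cat_rcons => /and3P[_ P1 _].
have := label_perm _ _ P1; have := label_perm _ _ P0; rewrite !all_cat /=.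
move=> /and4P[labR _ _ labw] /and4P[labR1 _ _ labw1].
have eR : R1 = R.
  apply: map_site_inj Sc labR1 labR _ _; rewrite ER1 ?ER // mem_iota.
  by move: lep; clear; lia.
have ew : w1 = w.
  apply: map_site_inj Sc labw1 labw _ _; rewrite Ew1 ?Ew // mem_iota.
  by clear; lia.
have P : perm_eq [:: a1; b1] [:: a; b].
  by rewrite -(perm_cat2r w) -(perm_cat2l R) -{1}eR -{1}ew (permPl P1) perm_sym.
by rewrite eR ew !inE; have [[-> ->]|[-> ->]] := perm_pair _ _ _ _ P; rewrite eqxx ?orbT.
Qed.

Lemma word_of_inj m p (c c' : iconf m) z : word_of m p c z -> word_of m p c' z -> c = c'.
Proof.
move=> /and3P[_ P /eqP E] /and3P[_ _ /eqP E']; apply/ffunP => k; apply: val_inj.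
have /eq_in_map/(_ k.+1) : [seq c (chip m l) : nat | l <- z.1 ++ z.2] =
    [seq c' (chip m l) : nat | l <- z.1 ++ z.2] by rewrite E E'.
by rewrite chipK; apply; rewrite (perm_mem P) mem_iota add1n !ltnS ltn_ord.
Qed.

Lemma conf_of_word m p z : 0 < p <= m -> size z.1 = p ->
  perm_eq (z.1 ++ z.2) (iota 1 (m + 1)) -> exists c : iconf m, word_of m p c z.
Proof.
move=> lep sz P; set w := z.1 ++ z.2.
have sw : size w = m + 1 by rewrite (perm_size P) size_iota.
have sT : size (start_sites m p) = m + 1.
  by rewrite size_cat !size_iota; move: lep; clear; lia.
have site_lt (k : 'I_(m + 1)) : nth 0 (start_sites m p) (index k.+1 w) < m + 2.
  have : index k.+1 w < m + 1.
    by rewrite -[X in _ < X]sw index_mem (perm_mem P) mem_iota add1n !ltnS ltn_ord.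
  rewrite -[X in _ < X -> _]sT => /(mem_nth 0); rewrite mem_cat !mem_iota.
  by move: lep (nth _ _ _); clear => lep e; lia.
exists [ffun k => Ordinal (site_lt k)]; rewrite /word_of sz eqxx P /= -/w.
apply/eqP/(@eq_from_nth _ 0); rewrite size_map sw ?sT // => i lti.
rewrite (nth_map 0) ?sw // ffunE /= -/(nat_of_ord (chip m (nth 0 w i))) chipE; last first.
  by apply: (allP (label_perm _ _ P)); rewrite mem_nth ?sw.
by rewrite index_uniq ?sw // (perm_uniq P) iota_uniq.
Qed.

(** Double counting of the pairs of a configuration toppling to [u ++ vs] and one of its words: each
    configuration has two words, each word one configuration. *)
Lemma card_topples_to m p u vs : 0 < p <= m ->
  perm_eq (u ++ vs) (iota 1 (m + 1)) -> size vs = p ->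
  #|[set c : iconf m | in_S m p c && `[< topples_to (as_lconf c) (u ++ vs) >]]| * 2
  = size (net_pre vs u).
Proof.
move=> lep P svs; set A := [set c | _].
have su : size u + p = m + 1.
  by have := perm_size P; rewrite size_cat size_iota svs.
have Pz z : z \in net_pre vs u -> size z.1 = p /\ perm_eq (z.1 ++ z.2) (iota 1 (m + 1)).
  case: z => R w /net_pre_net E; have [<- _] := net_size _ _ _ _ E; split=> //=.
  rewrite perm_sym; apply: perm_trans (net_perm _ _ _ _ E).
  by rewrite perm_sym perm_catC.
have netA c z : word_of m p c z -> (c \in A) = (z \in net_pre vs u).
  move=> wz; rewrite inE (word_of_in_S _ _ _ _ lep wz) /=.
  case: z wz => R w wz; have /and3P[/eqP /= sR Pw _] := wz.
  rewrite net_preP ?(perm_uniq Pw) ?iota_uniq //; case E: (net R w) => [vs' u'].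
  have T := topples_to_word _ _ _ _ _ _ (u ++ vs) lep wz E.
  have [svs' su'] := net_size _ _ _ _ E.
  apply/asboolP/eqP => [/T/eqP|[evs eu]]; last by apply/T; rewrite evs eu.
  rewrite eqseq_cat => [/andP[/eqP-> /eqP->] //|].
  by apply: (@addIn p); rewrite su su' [RHS]addnC -sR -size_cat (perm_size Pw) size_iota.
have count2 c : c \in A -> count (word_of m p c) (net_pre vs u) = 2.
  move=> memA; have Sc : in_S m p c by move: memA; rewrite inE => /andP[].
  have [z1 [z2 [nz wz]]] := word_of_two _ _ _ lep Sc.
  rewrite (eq_count wz) -(size_filter) (perm_size (_ : perm_eq _ [:: z1; z2])) //.
  apply: uniq_perm; rewrite ?filter_uniq ?net_pre_uniq //= ?inE ?nz //.
  move=> z; rewrite mem_filter; case: (boolP (z \in [:: z1; z2])) => //= memz.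
  by rewrite -(netA c) // wz.
rewrite -sum1_size -sum_nat_const -(eq_bigr _ count2).
transitivity (\sum_(z <- net_pre vs u) \sum_(c in A) word_of m p c z).
  rewrite exchange_big; apply: eq_bigr => c _ /=.
  by rewrite -sum1_count big_mkcond; apply: eq_bigr => z _; case: word_of.
rewrite big_seq [RHS]big_seq; apply: eq_bigr => z memz.
have [sz Pzz] := Pz _ memz; have [c wz] := conf_of_word _ _ _ lep sz Pzz.
rewrite (bigD1 c) ?(netA _ _ wz) //= wz big1 // => c' /andP[_ nc].
by apply/eqP; rewrite eqb0; apply: contra nc => wz'; apply/eqP/(word_of_inj _ _ _ _ _ wz' wz).
Qed.

Theorem theorem2p12 (n p : nat) (pi : seq nat) :
  (2 <= n)%N -> (1 <= p <= n.-1)%N ->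
  perm_eq pi (iota 1 n) ->
  p_resultant n p pi ->
  ((#|[set c : iconf n.-1 | in_S n.-1 p c && `[< topples_to (as_lconf c) pi >]]|)%:R : rat)
    = ((polyBernoulliB (lr_maxima (take (n - p) pi)) (rl_minima (drop (n - p) pi)))%:R / 2)%R.
Proof.
case: n => // m _ /= lep P [c0 [/= Sc0 top0]].
have {}P : perm_eq pi (iota 1 (m + 1)) by rewrite addn1.
set u := take _ pi; set vs := drop _ pi.
have epi : u ++ vs = pi by apply: cat_take_drop.
have sizes : size vs = p.
  rewrite size_drop (perm_size P) size_iota.
  by move: lep; clear; lia.
rewrite -epi in P top0.
have card2 := card_topples_to _ _ _ _ lep P sizes; rewrite epi in card2 top0.
have U : uniq (vs ++ u) by rewrite uniq_catC (perm_uniq P) iota_uniq.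
have n0 : 0 \notin vs ++ u by rewrite mem_cat orbC -mem_cat (perm_mem P) mem_iota.
have size_pre := size_net_pre _ _ U n0.
(* Otherwise the grid would have no input with this output, against the configuration [c0]. *)
have ltuvs : allrel ltn u vs.
  apply: contraT => nlt; move: card2; rewrite size_pre (negbTE nlt) => /eqP.
  rewrite muln_eq0 orbF cards_eq0 => /eqP/setP/(_ c0); rewrite !inE Sc0 /=.
  by move=> /asboolPn.
have [Uvs Uu] : uniq vs /\ uniq u by move: U; rewrite cat_uniq => /and3P[].
have nu0 : 0 \notin u by apply: contra n0; rewrite mem_cat orbC => ->.
rewrite lr_maxima_records // rl_minima_minima //.
move: card2; rewrite size_pre ltuvs => <-.
by rewrite natrM mulfK.
Qed.
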